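(* For every $p\in(0,\tfrac15)$ there is a constant $c=c(p)>0$ such that for every $M>1$ there exists a dyadic $A_1$ weight $w$ on $I_0=[0,1]$ with $M\le [w]_{A_1}<\infty$ and $$ \sup_{(\varepsilon_J)}\ \|T_{\varepsilon}\|_{L^1(w)\to L^{1,\infty}(w)}\ \ge\ c\,[w]_{A_1}\,\log^{p}[w]_{A_1}, $$ where the supremum is over all sequences $(\varepsilon_J)_{J\in D,\,J\subseteq I_0}$ with $|\varepsilon_J|\le 1$, $T_\varepsilon$ is the corresponding martingale transform, and $[w]_{A_1}$ is the dyadic $A_1$ constant.
   Context: $D$ is the family of dyadic subintervals of $I_0=[0,1]$ (including $I_0$). For $J\in D$, $h_J$ is the Haar function equal to $|J|^{-1/2}$ on the right half $J_+$ of $J$, $-|J|^{-1/2}$ on the left half $J_-$, and $0$ off $J$. For a sequence $\varepsilon=(\varepsilon_J)_{J\in D}$ with $|\varepsilon_J|\le1$, the martingale transform is $T_\varepsilon\varphi=\sum_{J\in D}\varepsilon_J(\varphi,h_J)h_J$ (there is no constant term). A weight $w$ on $I_0$ is a positive integrable function; $\langle w\rangle_J=\frac1{|J|}\int_J w\,dx$; the dyadic constant $[w]_{A_1}$ is the least $Q$ such that $\langle w\rangle_J\le Q\inf_J w$ for all $J\in D$ (essential infimum), and $w$ is a dyadic $A_1$ weight if it is finite. With $w(E)=\int_Ew\,dx$, the weak norm $\|T_\varepsilon\|_{L^1(w)\to L^{1,\infty}(w)}\in[0,\infty]$ is the least $K$ such that $\lambda\,w(\{x\in I_0:|T_\varepsilon\varphi(x)|>\lambda\})\le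 K\int_{I_0}|\varphi|\,w\,dx$ for all $\lambda>0$ and all $\varphi\in L^1(I_0,w\,dx)$. *)

(* Defs.v *)
From mathcomp Require Import all_boot all_order all_algebra.
From mathcomp Require Import all_classical all_reals all_analysis.
From mathcomp Require Import ess_sup_inf.
Set Implicit Arguments.
Unset Strict Implicit.
Unset Printing Implicit Defensive.
Import Order.TTheory GRing.Theory Num.Theory.
Import numFieldNormedType.Exports.
Local Open Scope classical_set_scope.
Local Open Scope ring_scope.

Section Dyadic.
Variable R : realType.
Implicit Types (w phi : R -> R).

Local Notation mu := (@lebesgue_measure R).

Definition I0 : set R := `[0, 1].

(* [dyadic_itv n k] is the dyadic interval [k 2^-n, (k+1) 2^-n[.  The half-open
   convention makes the intervals of one generation disjoint; it only affects
   the countable set of dyadic endpoints. *)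
Definition dyadic_itv (n k : nat) : interval R :=
  `[k%:R / 2 ^+ n, k.+1%:R / 2 ^+ n[.

(* The family D: a generation [n] and a position [k < 2 ^ n]. *)
Definition dyadic := {n : nat & 'I_(2 ^ n)}.

Definition itv_of (J : dyadic) : interval R := dyadic_itv (tag J) (tagged J).
Definition left_half (J : dyadic) : interval R :=
  dyadic_itv (tag J).+1 (tagged J).*2.
Definition right_half (J : dyadic) : interval R :=
  dyadic_itv (tag J).+1 (tagged J).*2.+1.

Definition len (J : dyadic) : R := 2 ^- tag J.

Definition haar (J : dyadic) (x : R) : R :=
  (Num.sqrt (len J))^-1 *
  (\1_[set` right_half J] x - \1_[set` left_half J] x).

Definition haar_coef phi (J : dyadic) : R :=
  \int[mu]_(x in I0) (phi x * haar J x).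

(* The series is summed generation by generation: at a given point at most one
   term of each generation is nonzero.  For integrable [phi] and bounded [eps]
   the partial sums form a transform of an L^1-bounded martingale and converge
   almost everywhere; on the null set where they diverge, [limn] has a default
   value. *)
Definition martingale_transform (eps : dyadic -> R) phi (x : R) : R :=
  limn (fun N : nat => \sum_(n < N) \sum_(k < 2 ^ n)
    let J : dyadic := Tagged (fun m : nat => 'I_(2 ^ m)) k in
    eps J * haar_coef phi J * haar J x).

Definition weight w : Prop :=
  (forall x, I0 x -> 0 < w x) /\ mu.-integrable I0 (EFin \o w).

Definition avg w (J : dyadic) : R :=
  (len J)^-1 * \int[mu]_(x in [set` itv_of J]) w x.

Definition ess_inf_on w (J : dyadic) : \bar R :=
  ess_inf (mrestr mu (measurable_itv (itv_of J))) (EFin \o w).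

(* Equal to +oo when no finite [Q] is admissible. *)
Definition A1_const w : \bar R :=
  ereal_inf [set Q%:E | Q in
    [set Q : R | forall J, ((avg w J)%:E <= Q%:E * ess_inf_on w J)%E]].

Definition dyadic_A1_weight w : Prop := weight w /\ (A1_const w < +oo)%E.

Definition weighted_measure w (E : set R) : \bar R :=
  (\int[mu]_(x in E) (w x)%:E)%E.

Definition in_L1 w phi : Prop :=
  measurable_fun I0 phi /\
  mu.-integrable I0 (fun x => (phi x * w x)%:E).

Definition weak_norm w (T : (R -> R) -> R -> R) : \bar R :=
  ereal_inf [set K : \bar R | (0 <= K)%E /\
    forall (lambda : R) (phi : R -> R), 0 < lambda -> in_L1 w phi ->
      (lambda%:E *
         weighted_measure w (I0 `&` [set x | (lambda < `|T phi x|)%R])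
       <= K * \int[mu]_(x in I0) (`|phi x| * w x)%:E)%E].

End Dyadic.

(* Main.v *)
Require Import Defs.
From mathcomp Require Import all_boot all_order all_algebra.
From mathcomp Require Import all_classical all_reals all_analysis.
From mathcomp Require Import ess_sup_inf measurable_realfun ring lra.
Set Implicit Arguments.
Unset Strict Implicit.
Unset Printing Implicit Defensive.
Import Order.TTheory GRing.Theory Num.Theory.
Import numFieldNormedType.Exports.
Local Open Scope classical_set_scope.
Local Open Scope ring_scope.

(* The weight, the test function and the signs come from one finite dyadic tree,
   built in [4 ^ k] rounds with [q = 4 ^- k = [w]^-1].  A round on an interval of
   [w]-average [X] follows a nested sequence of [k] subintervals down to relative
   size about [q]; along it the average of [w] oscillates between [X] and about
   [3X/4], the average of [phi] grows geometrically from about [q] to [1/2], and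
   the final piece carries [w = q X] and [phi = 1].  Off this sequence new rounds
   start, except on lost pieces where [w = q X]; one lost piece carries
   [phi = - q], which makes the mean of [phi] over the round zero.
   At the level where [phi] has average [s], which a point reaches with
   [w]-probability about [q / s], the signs move [T phi] by a multiple of [s],
   upwards on the half with the larger [w]-average.  So each of the [k] levels
   contributes about [q] to the [w]-mean of [T phi]; the [w]-mass lost in one
   round is only [O(q)], whence after [1 / q] rounds the mean is about [k], the
   second moment is [O(k ^ 2)], and Paley-Zygmund gives [T phi >~ k] on a fixed
   fraction of the [w]-mass, while [int |phi| w = O(q)].  The weak norm is thus at
   least of order [k / q ~ [w] log [w]], which is more than the theorem asks. *)

(** * Weighted moments on finite binary trees *)

Section Trees.
Variable R : realType.

(* A leaf carries the values of [w] and [phi]; the flag of a node says whether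
   the transform uses the sign [-1] or [0] there. *)
Inductive tree := Leaf of R & R | Node of bool & tree & tree.

Fixpoint mean_phi (t : tree) : R :=
  match t with
  | Leaf _ f => f
  | Node _ l r => (mean_phi l + mean_phi r) / 2
  end.

Definition jump (s : bool) (l r : tree) : R :=
  s%:R * (mean_phi l - mean_phi r) / 2.

(* [g] accumulates the value of the transform along a branch. *)
Fixpoint mean (h : R -> R -> R -> R) (t : tree) (g : R) : R :=
  match t with
  | Leaf u f => h g u f
  | Node s l r => (mean h l (g - jump s l r) + mean h r (g + jump s l r)) / 2
  end.

Definition mean_w t := mean (fun _ u _ => u) t 0.
Definition moment1 t := mean (fun g u _ => g * u) t 0.
Definition moment2 t := mean (fun g u _ => g ^+ 2 * u) t 0.
Definition cost t := mean (fun _ u f => `|f| * u) t 0.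

Lemma mean_const (h : R -> R -> R) t (g g' : R) :
  mean (fun _ => h) t g = mean (fun _ => h) t g'.
Proof.
elim: t g g' => [//|s l IHl r IHr] g g' /=.
by congr ((_ + _) / 2); [exact: IHl|exact: IHr].
Qed.

Lemma meanD h1 h2 t (g : R) :
  mean (fun g u f => h1 g u f + h2 g u f) t g = mean h1 t g + mean h2 t g.
Proof. by elim: t g => [//|s l IHl r IHr] g /=; rewrite IHl IHr; lra. Qed.

Lemma meanZ c h t (g : R) :
  mean (fun g u f => c * h g u f) t g = c * mean h t g.
Proof. by elim: t g => [//|s l IHl r IHr] g /=; rewrite IHl IHr; lra. Qed.

(** Starting at [g] instead of [0] shifts the transform at every leaf by [g]. This and its quadratic
    analogue below yield the node recursions; the inductions need an arbitrary starting value. *)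
Lemma mean_moment1 t g :
  mean (fun g u _ => g * u) t g = moment1 t + g * mean_w t.
Proof.
suff H : forall h, mean (fun g u _ => g * u) t (h + g) =
    mean (fun g u _ => g * u) t h + g * mean_w t.
  by rewrite -[X in mean _ _ X]add0r H.
rewrite /mean_w; elim: t => [u f|s l IHl r IHr] h /=; first by ring.
rewrite [h + g - _]addrAC IHl [h + g + _]addrAC IHr.
rewrite (mean_const (fun u _ => u) l (0 - _) 0) (mean_const (fun u _ => u) r (0 + _) 0).
by lra.
Qed.

Lemma mean_moment2 t g :
  mean (fun g u _ => g ^+ 2 * u) t g =
  moment2 t + g * moment1 t *+ 2 + g ^+ 2 * mean_w t.
Proof.
suff H : forall h, mean (fun g u _ => g ^+ 2 * u) t (h + g) =
    mean (fun g u _ => g ^+ 2 * u) t h + g * mean (fun g u _ => g * u) t h *+ 2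
    + g ^+ 2 * mean_w t.
  by rewrite -[X in mean _ _ X]add0r H.
rewrite /mean_w; elim: t => [u f|s l IHl r IHr] h /=; first by ring.
rewrite [h + g - _]addrAC IHl [h + g + _]addrAC IHr.
rewrite (mean_const (fun u _ => u) l (0 - _) 0) (mean_const (fun u _ => u) r (0 + _) 0).
by field.
Qed.

Lemma mean_w_node s l r : mean_w (Node s l r) = (mean_w l + mean_w r) / 2.
Proof.
by rewrite /mean_w /= (mean_const (fun u _ => u) l _ 0)
  (mean_const (fun u _ => u) r _ 0).
Qed.

Lemma cost_node s l r : cost (Node s l r) = (cost l + cost r) / 2.
Proof.
by rewrite /cost /= (mean_const (fun u f => `|f| * u) l _ 0)
  (mean_const (fun u f => `|f| * u) r _ 0).
Qed.

(** The cross term is the source of the gain: a jump upwards on the half with the larger [w]-average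
    raises the first moment. *)
Lemma moment1_node s l r : moment1 (Node s l r) =
  (moment1 l + moment1 r + jump s l r * (mean_w r - mean_w l)) / 2.
Proof. by rewrite {1}/moment1 /= !mean_moment1; lra. Qed.

Lemma moment2_node s l r : moment2 (Node s l r) =
  (moment2 l + moment2 r + jump s l r * (moment1 r - moment1 l) *+ 2
   + jump s l r ^+ 2 * (mean_w l + mean_w r)) / 2.
Proof. by rewrite {1}/moment2 /= !mean_moment2; field. Qed.

(** * Lower bounds and the A1 condition on trees, and a Paley-Zygmund bound *)

Fixpoint above (m : R) (t : tree) : Prop :=
  match t with
  | Leaf u _ => m <= u
  | Node _ l r => above m l /\ above m r
  end.

(** The witness [m] stands for a lower bound of the essential infimum over the node. *)
Fixpoint tree_A1 (Q : R) (t : tree) : Prop :=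
  (exists m, [/\ 0 < m, above m t & mean_w t <= Q * m]) /\
  (if t is Node _ l r then tree_A1 Q l /\ tree_A1 Q r else True).

Lemma above_le m m' t : m' <= m -> above m t -> above m' t.
Proof.
move=> mm'; elim: t => [u f /=|s l IHl r IHr /= []]; first exact: le_trans.
by split; [exact: IHl|exact: IHr].
Qed.

Lemma above_mean_le (h1 h2 : R -> R -> R -> R) m t (g : R) : above m t ->
  (forall g u f, m <= u -> h1 g u f <= h2 g u f) -> mean h1 t g <= mean h2 t g.
Proof.
move=> + h12; elim: t g => [u f g /=|s l IHl r IHr g /= [al ar]]; first exact: h12.
by rewrite ler_pM2r ?invr_gt0// lerD// ?IHl// IHr.
Qed.

(* Paley-Zygmund: integrate [g <= lambda + tau 1_{g > lambda} + g^2 / (4 tau)]. *)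
Lemma paley_zygmund t (lambda tau : R) : above 0 t -> 0 < lambda -> 0 < tau ->
  moment1 t <= lambda * mean_w t
    + tau * mean (fun g u _ => (lambda < `|g|)%R%:R * u) t 0
    + moment2 t / (4 * tau).
Proof.
move=> t0 l0 tau0.
rewrite /mean_w [_ / _]mulrC /moment2 -!meanZ -!meanD.
apply: above_mean_le t0 _ => g u f u0.
have H : g <= tau + g ^+ 2 / (4 * tau).
  have -> : g ^+ 2 / (4 * tau) = g + ((g - 2 * tau) ^+ 2 / (4 * tau) - tau).
    by field; rewrite gt_eqF.
  have := divr_ge0 (sqr_ge0 (g - 2 * tau)) (ltW (mulr_gt0 (ltr0n _ 4) tau0)).
  by lra.
have H0 : 0 <= g ^+ 2 / (4 * tau) by rewrite divr_ge0 ?sqr_ge0 ?mulr_ge0 ?ltW.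
have -> : lambda * u + tau * ((lambda < `|g|)%R%:R * u) +
   (4 * tau)^-1 * (g ^+ 2 * u) = (lambda + tau * (lambda < `|g|)%R%:R +
   g ^+ 2 / (4 * tau)) * u by ring.
apply: ler_wpM2r => //; case: ltP => /= [_|gl]; first by lra.
by have := ler_norm g; lra.
Qed.


(** * The cascade *)

Section Cascade.
Variables (k : nat) (q : R).
(** A left half with a quarter at [q X] and the rest at [X] averages [(3 + q) X / 4]; a right half
    at [h X] restores the average [X]. *)
Local Notation h := ((5 - q) / 4).
Implicit Types (X Y : R) (rt : R -> tree) (j n : nat).

(** [rt] is the next round as a function of its average, and [j] counts the levels still to go. At
    the end, [2 - q] balances the leaf where [phi = 1]. *)
Fixpoint spine (rt : R -> tree) (j : nat) (X : R) : tree :=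
  match j with
  | 0 => Node false (Leaf (q * X) 1) (rt ((2 - q) * X))
  | j'.+1 =>
    Node true
      (Node false (Node false (Leaf (q * X) 0) (rt X)) (spine rt j' X))
      (rt (h * X))
  end.

(** The head of a round is shaped like a spine level, with sign [0]. The spine, of relative length
    [1 / 4] and [phi]-mean [q / 2], is cancelled by the leaf of length [1 / 8] with [phi = - q]. *)
Fixpoint cascade (n : nat) (X : R) : tree :=
  match n with
  | 0 => Leaf X 0
  | n'.+1 =>
    Node false
      (Node false (Node false (Leaf (q * X) (- q)) (cascade n' X))
         (spine (cascade n') k X))
      (cascade n' (h * X))
  end.

Hypotheses (q_gt0 : 0 < q) (q_le1 : q <= 1) (qE : q = 4^-1 ^+ k).

Local Ltac qlra := move: q_gt0 q_le1; lra.

(** * Averages and the A1 condition of the cascade *)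

Lemma spine_mean_phi rt j X : (forall Y : R, mean_phi (rt Y) = 0) ->
  mean_phi (spine rt j X) = 4^-1 ^+ j / 2.
Proof.
move=> rt0; elim: j => [|j IH] /=; first by rewrite rt0 expr0; qlra.
by rewrite !rt0 IH exprS; qlra.
Qed.

Lemma cascade_mean_phi n X : mean_phi (cascade n X) = 0.
Proof.
elim: n X => [//|n IH] X /=.
by rewrite !IH spine_mean_phi// qE; qlra.
Qed.

Lemma spine_mean_w rt j X : (forall Y : R, mean_w (rt Y) = Y) ->
  mean_w (spine rt j X) = X.
Proof.
move=> rtE; elim: j => [|j IH] /=; rewrite !mean_w_node !rtE /mean_w/=.
  by qlra.
by rewrite -/(mean_w _) IH; qlra.
Qed.

Lemma cascade_mean_w n X : mean_w (cascade n X) = X.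
Proof.
elim: n X => [//|n IH] X; rewrite [cascade _ _]/= !mean_w_node !IH spine_mean_w//.
by rewrite /mean_w/=; qlra.
Qed.

(** New rounds start at [X], [h X] or [(2 - q) X], all at least [X] because [q <= 1]. The parameter
    never decreases along a branch, so no leaf falls below [q X]. *)
Lemma spine_above rt j X : 0 <= X ->
  (forall Y : R, 0 <= Y -> above (q * Y) (rt Y)) -> above (q * X) (spine rt j X).
Proof.
move=> X0 rtA.
have IH' Y : X <= Y -> above (q * X) (rt Y).
  move=> XY; apply: above_le (rtA _ (le_trans X0 XY)).
  by rewrite ler_wpM2l// ltW.
elim: j => [|j IHj] /=; do !split => //; apply: IH' => //.
  by rewrite ler_peMl//; qlra.
by rewrite ler_peMl//; qlra.
Qed.

Lemma cascade_above n X : 0 <= X -> above (q * X) (cascade n X).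
Proof.
elim: n X => [|n IH] X X0; first by rewrite /= ler_piMl.
rewrite [cascade _ _]/=; split; first split.
- by split => //=; exact: IH.
- exact: spine_above.
- apply: above_le (IH _ _); last by rewrite mulr_ge0//; qlra.
  by rewrite ler_wpM2l ?(ltW q_gt0)// ler_peMl//; qlra.
Qed.

(** The bound [m = q X] serves at every node of the spine: as [q^-1 * (q * X) = X], it suffices that
    no average there exceeds [X]. The new rounds bring their own bounds. *)
Lemma spine_tree_A1 rt j X : 0 < X ->
  (forall Y : R, mean_w (rt Y) = Y) ->
  (forall Y : R, 0 <= Y -> above (q * Y) (rt Y)) ->
  (forall Y : R, 0 < Y -> tree_A1 q^-1 (rt Y)) ->
  tree_A1 q^-1 (spine rt j X).
Proof.
move=> X0 rtE rtA rtA1.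
have qX0 : 0 < q * X by rewrite mulr_gt0.
have qQ Y : q^-1 * (q * Y) = Y by rewrite mulKf// gt_eqF.
have rX : above (q * X) (rt X) by apply: rtA; exact: ltW.
have lf f : tree_A1 q^-1 (Leaf (q * X) f).
  split => //; exists (q * X); split => //=; rewrite /mean_w/= qQ.
  by rewrite ler_piMl// ltW.
have W j' : mean_w (spine rt j' X) = X by exact: spine_mean_w.
have S j' : above (q * X) (spine rt j' X) by apply: spine_above => //; exact: ltW.
elim: j => [|j IH].
  split; first by exists (q * X); split; [by []|exact: (S 0)|by rewrite qQ -[leRHS](W 0)].
  by split=> //; apply: rtA1; rewrite mulr_gt0//; qlra.
have qXX : q * X <= X by rewrite ler_piMl// ltW.
split; first by exists (q * X); split; [by []|exact: (S j.+1)|by rewrite qQ -[leRHS](W j.+1)].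
split; last by apply: rtA1; rewrite mulr_gt0//; qlra.
split.
  exists (q * X); split => //=.
  by rewrite qQ !mean_w_node W rtE /mean_w/=; qlra.
split => //; split; last by split => //; exact: rtA1.
exists (q * X); split => //=.
by rewrite qQ !mean_w_node rtE /mean_w/=; qlra.
Qed.

Lemma cascade_tree_A1 n X : 0 < X -> tree_A1 q^-1 (cascade n X).
Proof.
elim: n X => [|n IH] X X0.
  split => //; exists X; split => //=; rewrite /mean_w/= ler_peMl ?(ltW X0)//.
  by rewrite invf_ge1.
have qX0 : 0 < q * X by rewrite mulr_gt0.
have qQ Y : q^-1 * (q * Y) = Y by rewrite mulKf// gt_eqF.
have qXX : q * X <= X by rewrite ler_piMl// ltW.
have A Y : 0 <= Y -> above (q * Y) (cascade n Y) by exact: cascade_above.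
have AX : above (q * X) (cascade n X) by apply: A; exact: ltW.
have AS : above (q * X) (spine (cascade n) k X) by apply: spine_above => //; exact: ltW.
have W Y : mean_w (cascade n Y) = Y by exact: cascade_mean_w.
have WS : mean_w (spine (cascade n) k X) = X by exact: spine_mean_w.
split.
  exists (q * X); split; [by []|exact/(cascade_above n.+1)/ltW|].
  by rewrite qQ -[leRHS](cascade_mean_w n.+1).
split; last by apply: IH; rewrite mulr_gt0//; qlra.
split.
  exists (q * X); split => //=.
  by rewrite qQ !mean_w_node W WS /mean_w/=; qlra.
split; last exact: spine_tree_A1.
split; last first.
  split; last exact: IH.
  by split => //; exists (q * X); split => //=; rewrite /mean_w/= qQ.
exists (q * X); split => //=.
by rewrite qQ !mean_w_node W /mean_w/=; qlra.
Qed.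

(** * Cost and moments of the cascade *)

Lemma spine_cost rt j X c : 0 < X -> 0 <= c ->
  (forall Y : R, 0 < Y -> cost (rt Y) <= c * Y) ->
  cost (spine rt j X) <= (c + 4^-1 ^+ j * q / 2) * X.
Proof.
move=> X0 c0 rtc.
have H1 : cost (rt ((2 - q) * X)) <= c * ((2 - q) * X).
  by apply: rtc; rewrite mulr_gt0//; qlra.
have H2 : cost (rt (h * X)) <= c * (h * X).
  by apply: rtc; rewrite mulr_gt0//; qlra.
have H3 := rtc _ X0.
have L (f : R) : cost (Leaf (q * X) f) = `|f| * (q * X) by [].
have cq : 0 <= c * q * X by rewrite !mulr_ge0// ltW.
elim: j => [|j IH]; rewrite [spine _ _ _]/= !cost_node L.
  rewrite normr1 expr0; move: H1 cq; rewrite -!mulrA; qlra.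
rewrite normr0 exprS; move: IH H2 H3 cq.
by qlra.
Qed.

(** A round adds [q ^ 2 X / 8] from the leaf with [phi = - q], and as much from the end of the
    spine, of relative length [q / 8] with [w = q X] and [phi = 1]. *)
Lemma cascade_cost n X : 0 < X -> cost (cascade n X) <= n%:R * q ^+ 2 / 4 * X.
Proof.
elim: n X => [|n IH] X X0; first by rewrite /cost/= normr0 !mul0r.
have H2 : cost (cascade n (h * X)) <= n%:R * q ^+ 2 / 4 * (h * X).
  by apply: IH; rewrite mulr_gt0//; qlra.
have H3 := IH _ X0.
have cn0 : 0 <= n%:R * q ^+ 2 / 4 by rewrite divr_ge0// mulr_ge0// sqr_ge0.
have H1 := spine_cost k X0 cn0 IH; rewrite -qE in H1.
have L (f : R) : cost (Leaf (q * X) f) = `|f| * (q * X) by [].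
rewrite [cascade _ _]/= !cost_node L normrN gtr0_norm//.
move: H1 H2 H3; rewrite -[n.+1%:R]natr1.
have cq : 0 <= n%:R * q ^+ 2 / 4 * q * X by rewrite !mulr_ge0// ltW.
by move: cq; qlra.
Qed.

(** The factor of [m] is the share of [w]-mass not lost in leaves. Going from [j] to [j + 1] levels,
    the jump is [4 ^- j / 8] and the [w]-averages differ by [(1 - q) X / 2]; weighted by relative
    length, all levels contribute equally. *)
Lemma spine_moment1 rt j X m : (forall Y, mean_w (rt Y) = Y) ->
  (forall Y, mean_phi (rt Y) = 0) ->
  (forall Y, moment1 (rt Y) = m * Y) ->
  moment1 (spine rt j X) =
  ((1 - q / 6 - q / 3 * 4^-1 ^+ j) * m + 4^-1 ^+ j * j%:R * (1 - q) / 8) * X.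
Proof.
move=> rtW rtF rtM.
have L (u f : R) : moment1 (Leaf u f) = 0 by rewrite /moment1/= mul0r.
elim: j => [|j IH].
  by rewrite /= moment1_node L rtM /jump/= mul0r !mul0r expr0; field.
rewrite [spine _ _ _]/= !moment1_node L !rtM IH !mean_w_node !rtW spine_mean_w//.
rewrite /jump/= !rtF spine_mean_phi// exprS -[j.+1%:R]natr1 /mean_w/=.
by field.
Qed.

(** [phi] and the signs do not depend on [X], and [w] is proportional to it, so the moment is some
    [m X]. A round replaces [m] by [A m + d], with gain [d] and surviving share [A] of the mass. *)
Lemma cascade_moment1 n : exists m,
  [/\ 0 <= m, m <= n%:R * (q * k%:R * (1 - q) / 32),
    n%:R * (q * k%:R * (1 - q) / 32) * (1 - n%:R * q / 2) <= m &
    forall X, moment1 (cascade n X) = m * X].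
Proof.
set d := q * k%:R * (1 - q) / 32.
have d0 : 0 <= d.
  by rewrite /d divr_ge0// mulr_ge0// ?mulr_ge0 ?subr_ge0// ltW.
elim: n => [|n [m [m0 mle mge mE]]].
  by exists 0; split; rewrite ?mul0r// => X; rewrite /moment1/= !mul0r.
(* The head of the round loses [q / 8], and the spine a quarter of [q / 6 + q ^ 2 / 3]. *)
pose A := 1 - q / 6 - q ^+ 2 / 12.
have q2 : q ^+ 2 <= q by rewrite expr2 ler_piMl// ltW.
have q20 : 0 <= q ^+ 2 by exact: sqr_ge0.
have A01 : 1 - q / 2 <= A <= 1 by rewrite /A; move: q2 q20; qlra.
have A0 : 0 <= A by move: A01; qlra.
have [A1 A2] := andP A01.
exists (A * m + d); split.
- by rewrite addr_ge0// mulr_ge0.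
- by rewrite -[n.+1%:R]natr1 [(n%:R + 1) * d]mulrDl mul1r lerD2r (le_trans _ mle)// ler_piMl.
- have q12 : 0 <= 1 - q / 2 by qlra.
  apply: le_trans (_ : (1 - q / 2) * m + d <= _); last first.
    by rewrite lerD2r ler_wpM2r.
  have := ler_wpM2l q12 mge.
  set b := n%:R * d * _ => H.
  apply: le_trans (_ : (1 - q / 2) * b + d <= _); last by rewrite lerD2r.
  rewrite -subr_ge0 (_ : _ - _ = d * (q * (n%:R + 1) / 2 + (n%:R * q) ^+ 2 / 4)).
    by rewrite mulr_ge0// addr_ge0// divr_ge0 ?sqr_ge0// mulr_ge0 ?addr_ge0// ltW.
  by rewrite /b -[n.+1%:R]natr1; field.
- move=> X.
  have mw := cascade_mean_w n; have mp := cascade_mean_phi n.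
  rewrite [cascade _ _]/= !moment1_node !mE.
  rewrite (@spine_moment1 _ _ _ m)// -qE.
  rewrite /jump /= /moment1/= mul0r /A /d.
  by field.
Qed.

(** In the cross term the first moment of the left half is nonnegative and is dropped, and
    [h <= 5 / 4]. The squared jumps sum to the term with [1 / 12]. *)
Lemma spine_moment2 rt j X m v : 0 < X -> 0 <= m -> 0 <= v ->
  (forall Y, mean_w (rt Y) = Y) ->
  (forall Y, mean_phi (rt Y) = 0) ->
  (forall Y, moment1 (rt Y) = m * Y) ->
  (forall Y, 0 < Y -> moment2 (rt Y) <= v * Y) ->
  moment2 (spine rt j X) <=
  (v + 4^-1 ^+ j * (j%:R * (5 / 8) * m + (1 - 4^-1 ^+ j) / 12)) * X.
Proof.
move=> X0 m0 v0 rtW rtF rtM rtV.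
have L (u f : R) : moment2 (Leaf u f) = 0 by rewrite /moment2/= expr0n/= mul0r.
have L1 (u f : R) : moment1 (Leaf u f) = 0 by rewrite /moment1/= mul0r.
have H1 : moment2 (rt ((2 - q) * X)) <= v * ((2 - q) * X).
  by apply: rtV; rewrite mulr_gt0//; qlra.
have H2 : moment2 (rt (h * X)) <= v * (h * X).
  by apply: rtV; rewrite mulr_gt0//; qlra.
have H3 := rtV _ X0.
have vq : 0 <= v * q * X by rewrite !mulr_ge0// ltW.
elim: j => [|j IH]; rewrite [spine _ _ _]/= !moment2_node !L.
  by move: H1 vq; rewrite /jump/= !mul0r expr0; lra.
have S0 : 0 <= moment1 (spine rt j X).
  rewrite (@spine_moment1 _ _ _ m)//.
  have q40 : 0 <= 4^-1 ^+ j :> R by rewrite exprn_ge0.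
  have q41 : 4^-1 ^+ j <= 1 :> R by rewrite exprn_ile1// invf_le1// ler1n.
  rewrite mulr_ge0 ?(ltW X0)// addr_ge0// ?divr_ge0// ?mulr_ge0// ?subr_ge0//.
  by have := ler_wpM2l (ltW q_gt0) q41; qlra.
set M := moment1 (spine rt j X) in S0.
rewrite !moment1_node L1 !mean_w_node !rtM !rtW spine_mean_w// /jump/=.
rewrite !rtF spine_mean_phi// [4^-1 ^+ j.+1]exprS -[j.+1%:R]natr1 -/M.
have -> : mean_w (Leaf (q * X) 0) = q * X by [].
set e : R := 4^-1 ^+ j in IH *.
have e0 : 0 <= e by rewrite exprn_ge0.
have eM : 0 <= e * M by rewrite mulr_ge0.
have emX : 0 <= e * m * X by rewrite !mulr_ge0// ltW.
have emqX : 0 <= e * m * q * X by rewrite !mulr_ge0// ltW.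
have jemX : 0 <= j%:R * e * m * X by rewrite !mulr_ge0// ltW.
have eeX : 0 <= e * e * X by rewrite !mulr_ge0// ltW.
rewrite !mul0r ?expr1; move: IH H2 H3 vq eM emX emqX eeX jemX.
lra.
Qed.

Lemma cascade_moment2 n X : 0 < X -> moment2 (cascade n X) <=
  n%:R * (q / 4 * (5 / 8 * k%:R * (n%:R * (q * k%:R / 32)) + 1 / 12)) * X.
Proof.
elim: n X => [|n IH] X X0.
  by rewrite /moment2/= expr0n/= !mul0r.
have [m [m0 mle _ mE]] := cascade_moment1 n.
have mp := cascade_mean_phi n.
have mle' : m <= n%:R * (q * k%:R / 32).
  apply: le_trans mle _; rewrite ler_wpM2l// ler_pM2r// ler_piMr ?mulr_ge0 ?(ltW q_gt0)//.
  by qlra.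
pose a := q / 4 * (5 / 8 * k%:R * (n%:R * (q * k%:R / 32)) + 1 / 12).
have a_ge0 : 0 <= a.
  have q0 := ltW q_gt0.
  by rewrite /a; do ?[apply: addr_ge0 => //|apply: mulr_ge0 => //]; rewrite invr_ge0.
have v0 : 0 <= n%:R * a by rewrite mulr_ge0.
have := spine_moment2 k X0 m0 v0 (cascade_mean_w n)
  mp mE IH.
rewrite -qE => SV.
have H2 : moment2 (cascade n (h * X)) <= n%:R * a * (h * X).
  by apply: IH; rewrite mulr_gt0//; qlra.
have H3 := IH _ X0.
have L (u f : R) : moment2 (Leaf u f) = 0 by rewrite /moment2/= expr0n/= mul0r.
(* The increment of a round grows with the bound on [m], so all earlier increments may be replaced
   by the last one. *)
apply: le_trans (_ : (n%:R + 1) * a * X <= _); last first.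
  rewrite natr1 ler_wpM2r ?(ltW X0)// ler_wpM2l// /a ler_wpM2l ?divr_ge0 ?(ltW q_gt0)//.
  rewrite lerD2r ler_wpM2l ?mulr_ge0// ler_wpM2r ?ler_nat//.
  by rewrite divr_ge0// mulr_ge0// ltW.
rewrite [cascade _ _]/= !moment2_node !L /jump/= !mul0r.
apply: le_trans (_ : n%:R * a * X + q / 4 * (k%:R * (5 / 8) * m + 1 / 12) * X <= _).
  have naq := mulr_ge0 (mulr_ge0 v0 (ltW q_gt0)) (ltW X0).
  have qqX : 0 <= q * q * X by rewrite !mulr_ge0// ltW.
  by move: SV H2 H3 naq qqX; rewrite -/a; lra.
have -> : (n%:R + 1) * a * X = n%:R * a * X + a * X by ring.
rewrite lerD2l ler_wpM2r ?(ltW X0)// /a.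
rewrite ler_wpM2l ?divr_ge0 ?(ltW q_gt0)// lerD2r.
by rewrite [k%:R * _]mulrC ler_wpM2l// mulr_ge0.
Qed.

End Cascade.

(** After [n = 4 ^ k = 1 / q] rounds the loss factor [1 - n q / 2] is still [1 / 2], while the gains
    add up to order [k]. The leftmost branch is exposed because its leaf will bound the A1 constant
    from below. *)
Lemma cascade_big_transform k : (0 < k)%N ->
  exists t : tree,
  [/\ mean_w t = 1, tree_A1 (4 ^+ k) t, above (4 ^- k) t,
    (exists f l2 l3 r,
      t = Node false (Node false (Node false (Leaf (4 ^- k) f) l2) l3) r) &
    cost t <= 4 ^- k / 4 /\
    1 / 1024 <= mean (fun g u _ => (k%:R / 512 < `|g|)%R%:R * u) t 0].
Proof.
move=> k0.
pose q : R := 4^-1 ^+ k.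
have q0 : 0 < q by rewrite exprn_gt0// invr_gt0.
have q4 : q <= 1 / 4.
  rewrite /q -(prednK k0) exprS mul1r ler_piMr// ?invr_ge0//.
  by rewrite exprn_ile1// invf_le1// ler1n.
have q1 : q <= 1 by lra.
have qV : 4 ^- k = q by rewrite -exprVn.
have qK : 4 ^+ k = q^-1 by rewrite -qV invrK.
rewrite qV qK.
have nq : (4 ^ k)%N%:R * q = 1 by rewrite natrX qK mulVf// gt_eqF.
have n0 : (4 ^ k)%N = (4 ^ k).-1.+1 by rewrite prednK// expn_gt0.
have k1 : 1 <= k%:R :> R by rewrite ler1n.
pose t := cascade k q (4 ^ k) 1; exists t.
have tA : above q t by rewrite -[q]mulr1; exact: cascade_above.
have tW : mean_w t = 1 by exact: cascade_mean_w.
split => //.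
- exact: cascade_tree_A1.
- by rewrite /t n0 /= mulr1; do 4 eexists.
split.
  have := cascade_cost q0 q1 erefl (4 ^ k) ltr01.
  by rewrite expr2 mulrA nq mul1r mulr1.
have [m [m0 mle mge mE]] := cascade_moment1 q0 q1 erefl (4 ^ k).
have := cascade_moment2 q0 q1 erefl (4 ^ k) ltr01.
have q5 : q * (5 / 8) = 5 / 8 * q by exact: mulrC.
rewrite mulr1 => V.
have {}V : moment2 t <= k%:R ^+ 2 / 32.
  apply: le_trans V _.
  have -> : (4 ^ k)%N%:R * (q / 4 * (5 / 8 * k%:R * ((4 ^ k)%N%:R *
    (q * k%:R / 32)) + 1 / 12)) = ((4 ^ k)%N%:R * q) / 4 * (5 / 8 * k%:R *
    (((4 ^ k)%N%:R * q) * k%:R / 32) + 1 / 12) by ring.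
  rewrite nq !mul1r.
  have : 1 <= k%:R ^+ 2 :> R by rewrite exprn_ege1.
  by rewrite expr2; lra.
have {mE}M : k%:R / 128 <= moment1 t.
  rewrite mE mulr1; apply: le_trans mge.
  have -> : (4 ^ k)%N%:R * (q * k%:R * (1 - q) / 32) * (1 - (4 ^ k)%N%:R * q / 2) =
    ((4 ^ k)%N%:R * q) * k%:R * (1 - q) / 32 * (1 - (4 ^ k)%N%:R * q / 2) by ring.
  rewrite nq.
  have : k%:R * q <= k%:R * (1 / 4) by rewrite ler_wpM2l.
  by lra.
have k2 : 0 < 2 * k%:R :> R by rewrite mulr_gt0// ltr0n.
have k5 : 0 < k%:R / 512 :> R by rewrite divr_gt0// ltr0n.
(* With [lambda = k / 512] and [tau = 2 k], what remains is
   [k / 128 - k / 512 - k / 256 = tau / 1024]. *)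
have := paley_zygmund (above_le (ltW q0) tA) k5 k2.
rewrite tW; set P := mean _ _ _ => PZ.
have V' : moment2 t / (4 * (2 * k%:R)) <= k%:R / 256.
  rewrite ler_pdivrMr; last by rewrite mulr_gt0.
  by apply: le_trans V _; rewrite expr2; lra.
rewrite -(ler_pM2l k2); lra.
Qed.

End Trees.

(** * Dyadic step functions and their transforms *)

Section StepFunctions.
Variable R : realType.
Local Notation mu := (@lebesgue_measure R).
Local Notation I0 := (@Defs.I0 R).
Local Notation D n k := [set` Defs.dyadic_itv R n k].
Implicit Types (t l r : tree R) (h : R -> R -> R -> R) (g x : R).

(** The tree is laid over the dyadic interval of generation [n] and position [k]. Only midpoints are
    compared, so values exist on the whole line; from the root, [x = 1] gets the last leaf. *)
Fixpoint step h t (n k : nat) g x : R :=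
  match t with
  | Leaf u f => h g u f
  | Node s l r =>
    if x < k.*2.+1%:R / 2 ^+ n.+1
    then step h l n.+1 k.*2 (g - jump s l r) x
    else step h r n.+1 k.*2.+1 (g + jump s l r) x
  end.

Lemma measurable_step h t n k g (A : set R) : measurable_fun A (step h t n k g).
Proof.
apply: (@measurable_funS _ _ _ _ setT) => //.
elim: t n k g => [u f|s l IHl r IHr] n k g /=; first exact: measurable_cst.
apply: measurable_fun_ifT => //.
by apply: measurable_fun_ltr; [exact: measurable_id|exact: measurable_cst].
Qed.

Lemma bounded_step h t n k g : exists M, forall x, `|step h t n k g x| <= M.
Proof.
elim: t n k g => [u f|s l IHl r IHr] n k g /=; first by exists `|h g u f|.
have [Ml Hl] := IHl n.+1 k.*2 (g - jump s l r).
have [Mr Hr] := IHr n.+1 k.*2.+1 (g + jump s l r).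
exists (Num.max Ml Mr) => x; rewrite le_max.
by case: ifP => _; rewrite ?Hl ?Hr ?orbT.
Qed.

Lemma integrable_step h t n k g (i : interval R) : (mu [set` i] < +oo)%E ->
  mu.-integrable [set` i] (EFin \o step h t n k g).
Proof.
move=> ioo; apply: measurable_bounded_integrable => //.
- exact: measurable_step.
- have [M HM] := bounded_step h t n k g.
  exists M; split; first exact: num_real.
  by move=> y My x _; rewrite /= (le_trans (HM x))// ltW.
Qed.

Lemma dyadic_mid n k : k%:R / 2 ^+ n = k.*2%:R / 2 ^+ n.+1 :> R.
Proof.
by rewrite -muln2 natrM exprS; field; rewrite expf_neq0.
Qed.

Lemma dyadic_measure n k : mu (D n k) = (2 ^- n)%:E.
Proof.
rewrite lebesgue_measure_itv/= lte_fin ltr_pM2r ?invr_gt0 ?exprn_gt0//.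
rewrite ltr_nat ltnSn -EFinB -mulrBl -natrB// subSnn mul1r//.
Qed.

Lemma dyadic_split n k : D n k = D n.+1 k.*2 `|` D n.+1 k.*2.+1.
Proof.
rewrite /Defs.dyadic_itv dyadic_mid [k.+1%:R / _]dyadic_mid doubleS.
have H (i : nat) : i%:R / 2 ^+ n.+1 <= i.+1%:R / 2 ^+ n.+1 :> R.
  by rewrite ler_pM2r ?invr_gt0 ?exprn_gt0// ler_nat.
apply/seteqP; split => x /=; rewrite !in_itv/=.
  by move=> /andP[a b]; case: (ltP x (k.*2.+1%:R / 2 ^+ n.+1)) => c;
    [left|right]; apply/andP.
case=> /andP[a b]; apply/andP; split => //.
  by rewrite (lt_le_trans b).
by rewrite (le_trans _ a).
Qed.

Lemma dyadic_disjoint n k : [disjoint D n k & D n k.+1].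
Proof.
apply/disj_setPS => x /= []; rewrite !in_itv/= => /andP[_ a] /andP[b _].
by have := lt_le_trans a b; rewrite ltxx.
Qed.

Lemma integral_step h t n k g :
  \int[mu]_(x in D n k) step h t n k g x = 2 ^- n * mean h t g.
Proof.
elim: t n k g => [u f|s l IHl r IHr] n k g.
  by rewrite Rintegral_cst//= dyadic_measure/= mulrC.
rewrite [in LHS]dyadic_split Rintegral_setU//; last 2 first.
- rewrite -dyadic_split; apply: (@integrable_step h (Node s l r)).
  by rewrite /= dyadic_measure ltry.
- exact: dyadic_disjoint.
transitivity (\int[mu]_(x in D n.+1 k.*2) step h l n.+1 k.*2 (g - jump s l r) x
    + \int[mu]_(x in D n.+1 k.*2.+1) step h r n.+1 k.*2.+1 (g + jump s l r) x).
  congr (_ + _); apply: eq_Rintegral => x; rewrite inE/= in_itv/= => /andP[a b].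
    by rewrite b.
  by rewrite ltNge a.
by rewrite IHl IHr/= exprS invfM -mulrDr; field; rewrite expf_neq0.
Qed.

(** * Subtrees over dyadic intervals *)

Definition child (b : bool) t : tree R :=
  if t is Node _ l r then if b then r else l else t.

(** Position [k] of generation [n + 1] lies in position [k./2] of generation [n], on the right when
    [k] is odd. A leaf is its own child, so every dyadic interval has a subtree. *)
Fixpoint subtree t (n k : nat) : tree R :=
  match n with
  | 0 => t
  | n'.+1 => child (odd k) (subtree t n' k./2)
  end.

Definition active t : bool := if t is Node s _ _ then s else false.

(** The minus sign turns the right-minus-left of Haar coefficients into the left-minus-right of
    [jump]. *)
Definition signs t (J : dyadic) : R := - (active (subtree t (tag J) (tagged J)))%:R.

Definition node_jump t : R := if t is Node s l r then jump s l r else 0.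

Lemma step_child h t n k g x : D n.+1 k x ->
  step h t n k./2 g x =
  step h (child (odd k) t) n.+1 k
    (if odd k then g + node_jump t else g - node_jump t) x.
Proof.
case: t => [u f|s l r] /=; first by case: odd; rewrite /= ?addr0 ?subr0.
rewrite in_itv/=; move: (odd k) (k./2) (odd_double_half k) => b j <- {k}.
case: b; rewrite ?add1n ?add0n => /andP[a b]; last by rewrite b.
by rewrite ltNge a.
Qed.

Lemma dyadic_parent n k x : D n.+1 k x -> D n k./2 x.
Proof.
rewrite (dyadic_split n k./2); move: (odd k) (k./2) (odd_double_half k) => b j <- {k}.
by case: b; rewrite ?add1n ?add0n; [right|left].
Qed.

Lemma dyadic_uniq n k k' x : D n k x -> D n k' x -> k = k'.
Proof.
move=> /=; rewrite !in_itv/= => /andP[a b] /andP[c d].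
have H (i j : nat) : i%:R / 2 ^+ n <= x -> x < j.+1%:R / 2 ^+ n -> (i <= j)%N.
  move=> ix xj; have := le_lt_trans ix xj.
  by rewrite ltr_pM2r ?invr_gt0 ?exprn_gt0// ltr_nat ltnS.
by apply/eqP; rewrite eqn_leq (H _ _ a d) (H _ _ c b).
Qed.

Lemma dyadic_exists n x : 0 <= x < 1 -> exists2 k, (k < 2 ^ n)%N & D n k x.
Proof.
move=> x01; elim: n => [|n [k kn]].
  by exists 0 => //=; rewrite in_itv/= expr0 mul0r divr1.
rewrite dyadic_split => -[] xk.
  by exists k.*2 => //; rewrite expnS mul2n ltn_double.
by exists k.*2.+1 => //; rewrite expnS mul2n ltn_Sdouble.
Qed.

Lemma mean_phiE t g : mean (fun _ _ f => f) t g = mean_phi t.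
Proof. by elim: t g => [//|s l IHl r IHr] g /=; rewrite IHl IHr. Qed.

Lemma step_const (h : R -> R -> R) t n k g g' x :
  step (fun _ => h) t n k g x = step (fun _ => h) t n k g' x.
Proof.
elim: t n k g g' => [//|s l IHl r IHr] n k g g' /=.
by case: ifP => _; [exact: IHl|exact: IHr].
Qed.

Lemma step_subtree (h : R -> R -> R) t n k x : (k < 2 ^ n)%N -> D n k x ->
  step (fun _ => h) t 0 0 0 x = step (fun _ => h) (subtree t n k) n k 0 x.
Proof.
elim: n k => [|n IH] k kn xk; first by move: kn; rewrite expn0 ltnS leqn0 => /eqP->.
have k2 : (k./2 < 2 ^ n)%N by rewrite ltn_half_double -mul2n -expnS.
rewrite (IH _ k2 (dyadic_parent xk)).
by rewrite (step_child _ _ _ xk)/=; exact: step_const.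
Qed.

Lemma integral_subtree (h : R -> R -> R) t n k : (k < 2 ^ n)%N ->
  \int[mu]_(x in D n k) step (fun _ => h) t 0 0 0 x =
  2 ^- n * mean (fun _ => h) (subtree t n k) 0.
Proof.
move=> kn; rewrite -(integral_step (fun _ => h) (subtree t n k) n k 0).
by apply: eq_Rintegral => x; rewrite inE => xk; exact: step_subtree.
Qed.

Lemma dyadic_sub_I0 n k : (k < 2 ^ n)%N -> D n k `<=` I0.
Proof.
move=> kn x /=; rewrite /Defs.I0/= !in_itv/= => /andP[a b]; apply/andP; split.
  by rewrite (le_trans _ a)// divr_ge0// exprn_ge0.
rewrite (le_trans (ltW b))// ler_pdivrMr ?exprn_gt0// mul1r.
by rewrite -natrX ler_nat.
Qed.

Lemma measurable_I0 : measurable (I0 : set (measurableTypeR R)).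
Proof. exact: measurable_itv. Qed.
#[local] Hint Resolve measurable_I0 : core.

Lemma lebesgue_I0 : mu I0 = 1%:E.
Proof. by rewrite lebesgue_measure_itv/= lte_fin ltr01 oppr0 adde0. Qed.

Lemma integrable_step_I0 h t n k g : mu.-integrable I0 (EFin \o step h t n k g).
Proof. by apply: integrable_step; rewrite lebesgue_I0 ltry. Qed.

(** * The transform as the value accumulated along a branch *)

Section Transform.
Variable t : tree R.
Let phi := step (fun _ _ f => f) t 0 0 0.

Lemma haar_coef_phi (J : dyadic) (T := subtree t (tag J) (tagged J)) :
  haar_coef phi J =
  Num.sqrt (len R J) * (mean_phi (child true T) - mean_phi (child false T)) / 2.
Proof.
case: J @T => n k /=; set J := existT _ n k; set T := subtree t n k.
have kl : (k.*2 < 2 ^ n.+1)%N by rewrite expnS mul2n ltn_double.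
have kr : (k.*2.+1 < 2 ^ n.+1)%N by rewrite expnS mul2n ltn_Sdouble.
have phiI (i : interval R) : [set` i] `<=` I0 ->
    mu.-integrable I0 (EFin \o (phi \* \1_[set` i])) /\
    \int[mu]_(x in I0) (phi x * \1_[set` i] x) = \int[mu]_(x in [set` i]) phi x.
  move=> iI; split.
    have -> : EFin \o (phi \* \1_[set` i]) = (EFin \o phi) \_ [set` i].
      by rewrite epatch_indic; apply/funext => x /=; rewrite EFinM.
    apply/integrable_restrict => //.
    apply: (@integrableS _ _ _ mu I0) => //; first exact: measurableI.
    exact: integrable_step_I0.
  rewrite -[in RHS](setIidr iI) Rintegral_mkcondr.
  by apply: eq_Rintegral => x _; rewrite patch_indic.
have [il El] := phiI _ (dyadic_sub_I0 kl).
have [ir Er] := phiI _ (dyadic_sub_I0 kr).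
have s0 : 0 < Num.sqrt (len R J) by rewrite sqrtr_gt0 invr_gt0 exprn_gt0.
rewrite /haar_coef.
transitivity (\int[mu]_(x in I0) ((Num.sqrt (len R J))^-1 *
    (phi x * \1_(D n.+1 k.*2.+1) x - phi x * \1_(D n.+1 k.*2) x))).
  by apply: eq_Rintegral => x _; rewrite /haar -mulrBr mulrCA.
rewrite RintegralZl//; last exact: (integrableB measurable_I0 ir il).
rewrite RintegralB// El Er !integral_subtree// !mean_phiE/=.
rewrite uphalf_double doubleK odd_double/= -/T -mulrBr.
have lE : 2 ^- n.+1 = Num.sqrt (len R J) ^+ 2 / 2 :> R.
  by rewrite sqr_sqrtr ?invr_ge0 ?exprn_ge0// /len/= exprS invfM mulrC.
by rewrite lE; field; rewrite gt_eqF.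
Qed.

Definition partial_transform n x : R := \sum_(m < n) \sum_(j < 2 ^ m)
  let J : dyadic := Tagged (fun m : nat => 'I_(2 ^ m)) j in
  signs t J * haar_coef phi J * haar J x.

Lemma haar_term n (j : 'I_(2 ^ n)) x (T := subtree t n j)
    (J : dyadic := Tagged (fun m : nat => 'I_(2 ^ m)) j) :
  signs t J * haar_coef phi J * haar J x =
  node_jump T * (\1_(D n.+1 j.*2.+1) x - \1_(D n.+1 j.*2) x).
Proof.
have s0 : 0 < Num.sqrt (len R J) by rewrite sqrtr_gt0 invr_gt0 exprn_gt0.
rewrite haar_coef_phi /haar /signs /= -/T.
rewrite /right_half /left_half/=.
set d := (\1_(D n.+1 j.*2.+1) x - _).
have -> : node_jump T = - (active T)%:R *
    (mean_phi (child true T) - mean_phi (child false T)) / 2.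
  by case: (T) => [u f|s l r] /=; rewrite ?mulN1r ?oppr0 ?mul0r// /jump; lra.
by field; rewrite gt_eqF.
Qed.

(** In each generation only the interval containing [x] contributes; its term adds [node_jump] on
    the right half and subtracts it on the left, exactly as [step] does. *)
Lemma step_partial_transform h n k x : (k < 2 ^ n)%N -> D n k x ->
  step h t 0 0 0 x = step h (subtree t n k) n k (partial_transform n x) x.
Proof.
elim: n k => [|n IH] k kn xk.
  by move: kn; rewrite expn0 ltnS leqn0 => /eqP->; rewrite /partial_transform big_ord0.
have k2 : (k./2 < 2 ^ n)%N by rewrite ltn_half_double -mul2n -expnS.
rewrite (IH _ k2 (dyadic_parent xk)) (step_child _ _ _ xk)/=; congr step.
rewrite /partial_transform big_ord_recr/= -/(partial_transform n x).
rewrite [X in _ = _ + X](bigD1 (Ordinal k2))//= [X in _ = _ + (_ + X)]big1 ?addr0; last first.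
  move=> j jk; rewrite haar_term !indicE !memNset ?subrr ?mulr0//.
    move=> xj; have /= := dyadic_uniq xj xk => jE.
    by move: jk; rewrite -val_eqE/= -jE doubleK eqxx.
  move=> xj; have /= := dyadic_uniq xj xk => jE.
  by move: jk; rewrite -val_eqE/= -jE/= uphalf_double eqxx.
rewrite haar_term/=; move: (node_jump _) xk => N.
move: (odd k) (k./2) (odd_double_half k) => b i <-.
case: b; rewrite ?add1n ?add0n => xk; rewrite !indicE (mem_set xk).
  rewrite memNset ?subr0 ?mulr1// => /(dyadic_uniq xk)/eqP.
  by rewrite eqn_leq ltnn.
rewrite memNset ?sub0r ?mulrN1// => /(dyadic_uniq xk)/eqP.
by rewrite eqn_leq ltnn andbF.
Qed.

Fixpoint depth t' := if t' is Node _ l r then (maxn (depth l) (depth r)).+1 else 0.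

Lemma depth_subtree n k : (depth (subtree t n k) <= depth t - n)%N.
Proof.
elim: n k => [|n IH] k; first by rewrite subn0.
rewrite subnS /=; case: (subtree t n k./2) (IH k./2) => [u f|s l r] /= H //.
have {}H : (maxn (depth l) (depth r) <= (depth t - n).-1)%N.
  by rewrite -ltnS (leq_trans H)// leqSpred.
by case: odd; apply: leq_trans H; rewrite ?leq_maxl ?leq_maxr.
Qed.

(** From generation [depth t] on all subtrees are leaves, so the partial sums are stationary. *)
Lemma martingale_transform_step x : 0 <= x < 1 ->
  martingale_transform (signs t) phi x = step (fun g _ _ => g) t 0 0 0 x.
Proof.
move=> x01; rewrite /martingale_transform; apply: lim_near_cst => //.
exists (depth t) => // n /= tn.
have [k kn xk] := dyadic_exists n x01.
rewrite (step_partial_transform _ kn xk).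
have := depth_subtree n k; move: tn; rewrite -subn_eq0 => /eqP->.
by case: subtree.
Qed.

End Transform.

End StepFunctions.

(** * Weights given by trees *)

Section TreeWeight.
Variables (R : realType) (t : tree R).
Local Notation mu := (@lebesgue_measure R).
Local Notation I0 := (@Defs.I0 R).
Local Notation D n k := [set` Defs.dyadic_itv R n k].
Let w := step (fun _ u _ => u) t 0 0 0.
Let phi := step (fun _ _ f => f) t 0 0 0.

Lemma step_above (m : R) t' n k g x : above m t' ->
  m <= step (fun _ u _ => u) t' n k g x.
Proof.
elim: t' n k g => [//|s l IHl r IHr] n k g /= [ml mr].
by case: ifP => _; [exact: IHl|exact: IHr].
Qed.

Lemma tree_weight (m : R) : 0 < m -> above m t -> weight w.
Proof.
move=> m0 mt; split; last exact: integrable_step_I0.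
by move=> x _; rewrite (lt_le_trans m0)// step_above.
Qed.

Lemma tree_avg (J : dyadic) : avg w J = mean_w (subtree t (tag J) (tagged J)).
Proof.
by rewrite /avg /itv_of integral_subtree// /len mulrA mulVf ?mul1r.
Qed.

(** * The A1 constant of a tree weight *)

Lemma tree_A1_subtree Q n k : tree_A1 Q t -> tree_A1 Q (subtree t n k).
Proof.
move=> tQ; elim: n k => [//|n IH] k /=.
by case: (subtree t n k./2) (IH k./2) => [//|s l r] /= [_ [Ql Qr]]; case: odd.
Qed.

Lemma ess_inf_on_tree (m : R) (J : dyadic) :
  above m (subtree t (tag J) (tagged J)) -> (m%:E <= ess_inf_on w J)%E.
Proof.
move=> mt; apply/ess_infP.
exists (~` [set` itv_of R J]); split.
- by apply: measurableC; exact: measurable_itv.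
- by rewrite /mrestr -[RHS](measure0 mu); congr (mu _); exact: setICl.
- move=> x /= H xJ; apply: H; rewrite /= lee_fin /w (step_subtree _ _ (ltn_ord (tagged J)) xJ).
  exact: step_above.
Qed.

Lemma tree_A1_const_le (Q : R) : 0 < Q -> tree_A1 Q t -> (A1_const w <= Q%:E)%E.
Proof.
move=> Q0 tQ; apply: ereal_inf_lbound; exists Q => // J.
have [m [m0 mt mQ]] : exists m, [/\ 0 < m,
    above m (subtree t (tag J) (tagged J)) &
    mean_w (subtree t (tag J) (tagged J)) <= Q * m].
  by case: subtree (tree_A1_subtree (tag J) (tagged J) tQ) => [u f|s l r] [].
rewrite tree_avg; apply: (@le_trans _ _ (Q%:E * m%:E)%E); first by rewrite lee_fin.
by rewrite lee_pmul2l// ?lte_fin// ess_inf_on_tree.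
Qed.

(** [w = q] on an interval of positive measure, so the essential infimum over the whole interval is
    at most [q]; against the mean [1] this forces [Q >= q^-1]. *)
Lemma tree_A1_const_ge (q f : R) n k : (k < 2 ^ n)%N -> 0 < q -> above 0 t ->
  mean_w t = 1 -> subtree t n k = Leaf q f -> ((q^-1)%:E <= A1_const w)%E.
Proof.
move=> kn q0 t0 t1 tq; apply: le_ereal_inf_tmp => _ [Q HQ <-].
have := HQ (existT (fun m => 'I_(2 ^ m)) 0%N ord0).
rewrite tree_avg/= t1.
set J := existT _ _ _; have : (ess_inf_on w J <= q%:E)%E.
  rewrite leNgt; apply/negP => qlt.
  have : (\forall x \ae mrestr mu (measurable_itv (itv_of R J)),
      ess_inf_on w J <= (w x)%:E)%E by exact/ess_infP.
  move=> [A [mA A0 HA]].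
  have : (mu (D n k) <= 0)%E.
    rewrite -A0; apply: le_measure; rewrite ?inE//.
      by apply: measurableI => //; exact: measurable_itv.
    move=> x xk; split.
      apply: HA => /=; apply/negP; rewrite -ltNge.
      by rewrite /w (step_subtree _ _ kn xk) tq.
    have : I0 x := dyadic_sub_I0 kn xk.
    rewrite /Defs.I0/= !in_itv/= expr0 !divr1 => /andP[-> _]/=.
    move: xk; rewrite /= in_itv/= => /andP[_ /lt_le_trans]; apply.
    by rewrite ler_pdivrMr ?exprn_gt0// mul1r -natrX ler_nat.
  by rewrite dyadic_measure lee_fin leNgt invr_gt0 exprn_gt0.
have e0 : (0 <= ess_inf_on w J)%E by exact: (@ess_inf_on_tree 0 J).
move=> eq1 le1.
(* The sign of [Q] is needed to multiply the bound on the essential infimum by it. *)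
have Q0 : 0 <= Q.
  rewrite leNgt; apply/negP => Qle0.
  suff : (1%:E <= 0%:E :> \bar R)%E by rewrite lee_fin ler10.
  apply: le_trans le1 _; apply: mule_le0_ge0 => //; rewrite lee_fin; exact: ltW.
have : (1%:E <= Q%:E * q%:E)%E by apply: le_trans le1 _; exact: lee_wpmul2l.
by rewrite !lee_fin => Qq; rewrite -[q^-1]mul1r ler_pdivrMr.
Qed.

(** * The weak norm from the tree *)

Lemma step_indicator (lambda : R) (t' : tree R) n k g x :
  step (fun g u _ => (lambda < `|g|)%R%:R * u) t' n k g x =
  (lambda < `|step (fun g _ _ => g) t' n k g x|)%R%:R *
  step (fun _ u _ => u) t' n k g x.
Proof.
elim: t' n k g => [//|s l IHl r IHr] n k g /=.
by case: ifP => _; [rewrite IHl|rewrite IHr].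
Qed.

Lemma step_cost (t' : tree R) n k g x :
  `|step (fun _ _ f => f) t' n k g x| * step (fun _ u _ => u) t' n k g x =
  step (fun _ u f => `|f| * u) t' n k g x.
Proof. by elim: t' n k g => [//|s l IHl r IHr] n k g /=; case: ifP. Qed.

Lemma step_product (t' : tree R) n k g x :
  step (fun _ _ f => f) t' n k g x * step (fun _ u _ => u) t' n k g x =
  step (fun _ u f => f * u) t' n k g x.
Proof. by elim: t' n k g => [//|s l IHl r IHr] n k g /=; case: ifP. Qed.

Lemma dyadic_itv00 : Defs.dyadic_itv R 0 0 = `[0, 1[.
Proof. by rewrite /Defs.dyadic_itv expr0 !divr1. Qed.

Lemma eintegral_step h :
  (\int[mu]_(x in `[0%R, 1%R[) (step h t 0 0 0 x)%:E)%E = (mean h t 0)%:E.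
Proof.
have := integral_step h t 0 0 0; rewrite dyadic_itv00 expr0 invr1 mul1r => <-.
rewrite fineK//; apply: integrable_fin_num => //.
apply: (@integrable_step _ h t 0 0 0 `[0, 1[).
by rewrite lebesgue_measure_itv/= lte_fin ltr01 oppr0 adde0 ltry.
Qed.

Lemma tree_cost : (\int[mu]_(x in I0) (`|phi x| * w x)%:E)%E = (cost t)%:E.
Proof.
rewrite -(eintegral_step (fun _ u f => `|f| * u)).
rewrite integral_itv_bndo_bndc; last first.
  by apply/measurable_EFinP; exact: measurable_step.
by apply: eq_integral => x _; rewrite step_cost.
Qed.

Lemma tree_superlevel (lambda : R) : above 0 t ->
  ((mean (fun g u _ => (lambda < `|g|)%R%:R * u) t 0)%:E <=
   weighted_measure w (I0 `&`
     [set x | (lambda < `|martingale_transform (signs t) phi x|)%R]))%E.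
Proof.
move=> t0; set T := martingale_transform _ _.
pose G := step (fun g _ _ => g) t 0 0 0.
pose A : set R := `[0, 1[ `&` [set x | lambda < `|G x|].
have mA : measurable (A : set (measurableTypeR R)).
  have mG : measurable_fun (`[0, 1[ : set (measurableTypeR R))
      (fun x => lambda < `|G x|).
    apply: measurable_fun_ltr; first exact: measurable_cst.
    by apply: measurableT_comp => //; exact: measurable_step.
  exact: (mG (measurable_itv _) [set true]).
have TG x : 0 <= x < 1 -> T x = G x by exact: martingale_transform_step.
have AE : A `<=` I0 `&` [set x | lambda < `|T x|].
  move=> x []; rewrite /= !in_itv/= => x01 xG; rewrite TG//; split => //.
  by rewrite /Defs.I0/= in_itv/=; case/andP: x01 => -> /ltW.
(* The set exceeds [A] by at most the point [1], so it is measurable whatever the transform is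
   there. *)
have mE : measurable ((I0 `&` [set x | lambda < `|T x|]) : set (measurableTypeR R)).
  have -> : I0 `&` [set x | lambda < `|T x|] =
      A `|` ([set 1] `&` [set x | lambda < `|T x|]).
    apply/seteqP; split => x; last first.
      case=> [/AE//|[/= -> H]]; split => //=.
      by rewrite /Defs.I0/= in_itv/= ler01 lexx.
    rewrite /Defs.I0/= in_itv/= => -[/andP[x0]]; rewrite le_eqVlt => /orP[/eqP->|x1] H.
      by right.
    by left; split; rewrite /= ?in_itv/= ?x0//= -TG// x0.
  apply: measurableU => //.
  case: (subset_set1 (@subIsetl _ [set 1] [set x | lambda < `|T x|])) => ->.
    exact: measurable0.
  exact: measurable_set1.
rewrite -(eintegral_step (fun g u _ => (lambda < `|g|)%R%:R * u)).
have -> : (\int[mu]_(x in `[0%R, 1%R[)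
    (step (fun g u _ => (lambda < `|g|)%R%:R * u) t 0 0 0 x)%:E =
    \int[mu]_(x in A) (w x)%:E)%E.
  rewrite /A integral_mkcondr; apply: eq_integral => x _.
  rewrite step_indicator patchE.
  case: ifPn => [/set_mem/= lx|]; first by rewrite lx mul1r.
  by case: ltP => [lx /negP[]|_ _]; [exact: mem_set|rewrite mul0r].
apply: ge0_subset_integral => //.
  by apply/measurable_EFinP; exact: measurable_step.
by move=> x _; rewrite lee_fin step_above.
Qed.

Lemma tree_weak_norm (lambda P c : R) : above 0 t -> 0 < lambda -> 0 < P ->
  0 < c -> cost t <= c ->
  P <= mean (fun g u _ => (lambda < `|g|)%R%:R * u) t 0 ->
  ((lambda * P / c)%:E <= weak_norm w (martingale_transform (signs t)))%E.
Proof.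
move=> t0 l0 P0 c0 tc tP; apply: le_ereal_inf_tmp => K [K0 HK].
have phi1 : in_L1 w phi.
  split; first exact: measurable_step.
  have -> : (fun x => (phi x * w x)%:E) =
      EFin \o step (fun _ u f => f * u) t 0 0 0.
    by apply/funext => x /=; rewrite step_product.
  exact: integrable_step_I0.
have := HK lambda phi l0 phi1; rewrite tree_cost => H.
have {}H : ((lambda * P)%:E <= K * c%:E)%E.
  apply: (@le_trans _ _ (K * (cost t)%:E)%E); last by rewrite lee_wpmul2l ?lee_fin.
  apply: le_trans H; rewrite EFinM lee_wpmul2l ?lee_fin ?(ltW l0)//.
  by apply: le_trans (tree_superlevel lambda t0); rewrite lee_fin.
by rewrite EFinM lee_pdivrMr.
Qed.

End TreeWeight.

(** * Choice of [k] and comparison with the logarithm *)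

Theorem theorem3p8 (R : realType) (p : R) (p_gt0 : 0 < p) (p_lt : p < 1 / 5) :
  exists c : R, 0 < c /\
    forall M : R, 1 < M ->
      exists w : R -> R,
        [/\ dyadic_A1_weight w,
            (M%:E <= A1_const w)%E &
            (c%:E * A1_const w * (ln (fine (A1_const w)) `^ p)%:E
             <= ereal_sup [set weak_norm w (martingale_transform eps) |
                  eps in [set eps : dyadic -> R |
                           forall J, (`|eps J| <= 1)%R]])%E].
Proof.
(* The factors are those of the level [k / 512] and of the mass [1 / 1024] above it. *)
have [c [cp cE]] : exists c : R, 0 < c /\ c = 1 / 512 * (1 / 1024).
  exists (1 / 512 * (1 / 1024)); split; last exact: erefl.
  by rewrite mulr_gt0 ?divr_gt0 ?ltr0n.
exists c; split => // M M1.
pose k := (Num.truncn M).+1.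
have k1 : 1 <= k%:R :> R by rewrite ler1n.
have Mk : M <= 4 ^+ k.
  have : M <= k%:R by apply/ltW/truncnS_gt.
  move/le_trans; apply; rewrite -natrX ler_nat.
  by apply: ltnW; exact: ltn_expl.
have [t [tw tA1 tA [f [l2 [l3 [r tE]]]] [tc tP]]] :=
  cascade_big_transform R (ltn0Sn (Num.truncn M)).
rewrite -/k in tw tA1 tA tE tc tP.
have q0 : 0 < 4 ^- k :> R by rewrite invr_gt0 exprn_gt0.
have t0 := above_le (ltW q0) tA.
pose w := step (fun _ u _ => u) t 0 0 0.
have A1E : A1_const w = (4 ^+ k)%:E.
  apply/eqP; rewrite eq_le tree_A1_const_le ?exprn_gt0//=.
  (* The exposed leaf sits in generation [3], at position [0]. *)
  rewrite -[4 ^+ k]invrK; apply: (@tree_A1_const_ge _ t (4 ^- k) f 3 0) => //.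
  by rewrite tE.
exists w; split.
- by split; [exact: tree_weight q0 tA|rewrite A1E ltry].
- by rewrite A1E lee_fin.
apply: le_ereal_sup_tmp.
exists (weak_norm w (martingale_transform (signs t))).
  exists (signs t) => // J; rewrite /signs normrN.
  by case: active; rewrite ?normr1 ?normr0.
have c0 : 0 < 4 ^- k / 4 :> R by rewrite divr_gt0.
have l0 : 0 < k%:R / 512 :> R by rewrite divr_gt0 ?ltr0n.
have P0 : 0 < 1 / 1024 :> R by rewrite divr_gt0 ?ltr0n.
apply: le_trans (tree_weak_norm t0 l0 P0 c0 tc tP).
rewrite A1E/= -!EFinM lee_fin.
have -> : k%:R / 512 * (1 / 1024) / (4 ^- k / 4) = c * 4 ^+ k * (4 * k%:R) :> R.
  by rewrite cE; field; rewrite expf_neq0.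
rewrite ler_wpM2l//; first by rewrite mulr_ge0 ?(ltW cp)// exprn_ge0.
(* From [ln (1 + 3) <= 3]. *)
have ln4 : 0 <= ln (4 ^+ k : R) <= 4 * k%:R.
  rewrite ln_ge0 ?exprn_ege1 ?ler1n//= lnXn// -[ln _ *+ k]mulr_natr ler_wpM2r//.
  have -> : 4 = 1 + 3 :> R by ring.
  by have := @le_ln1Dx R 3; lra.
have [ln0 ln1] := andP ln4.
apply: le_trans (_ : (4 * k%:R) `^ p <= _).
  by apply: ge0_ler_powR; rewrite ?nnegrE ?(ltW p_gt0) ?(le_trans ln0 ln1).
have k4 : 1 <= 4 * k%:R :> R by lra.
(* The weak norm supplies a full factor [4 k >= 1], which dominates its power [p <= 1]. *)
rewrite -[leRHS](powRr1 (le_trans ler01 k4)).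
by apply: ler_powR => //; lra.
Qed.
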